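(* For every integer $n\ge 0$, the atoms of the lattice $\mathcal{R}(n)$ (ordered by inclusion) are exactly the singletons $\{p\}$, $p\in\mathcal{Q}(n)$. The lattice $\mathcal{R}(n)$ is both atomic and atomistic, and its join-irreducible elements are exactly its atoms.
   Context: For an integer $n\ge 0$, let $\mathcal{Q}(n)=\{(x,y)\in\mathbb{Z}^2: 0\le x,\ 0\le y,\ x+y\le n\}$. Let $\mathcal{R}(n)$ be the set of all subsets $Y\subseteq\mathcal{Q}(n)$ such that: for any $(a,b),(c,d)\in Y$ with $\max(a,c)+\max(b,d)\le n+1$, we have $(\min(a,c),\min(b,d))\in Y$ and, additionally, $(\max(a,c),\max(b,d))\in Y$ as soon as $(\max(a,c),\max(b,d))\in\mathcal{Q}(n)$. Ordered by inclusion, $\mathcal{R}(n)$ is a finite lattice with minimum $\varnothing$ and maximum $\mathcal{Q}(n)$; its meet is intersection, and the join of $X,Y$ is the intersection of all elements of $\mathcal{R}(n)$ containing $X\cup Y$. Atomic: every non-minimum element lies above an atom. Atomistic: every element is a join of atoms. The minimum element $\varnothing$ is not counted as join-irreducible. *)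

(* Defs.v *)
From HB Require Import structures.
From mathcomp Require Import all_boot all_order.

Set Implicit Arguments.
Unset Strict Implicit.
Unset Printing Implicit Defensive.

Import Order.TTheory.

Section LatticeNotions.

Context {d : Order.disp_t} {L : finTBLatticeType d}.

Definition atom (x : L) : Prop :=
  (\bot < x)%O /\ forall y : L, (y < x)%O -> y = \bot%O.

Definition join_irreducible (x : L) : Prop :=
  x <> \bot%O /\ forall y z : L, x = (y `|` z)%O -> x = y \/ x = z.

End LatticeNotions.

Definition atomic {d : Order.disp_t} (L : finTBLatticeType d) : Prop :=
  forall x : L, x <> \bot%O -> exists2 a : L, atom a & (a <= x)%O.

(* The empty join is \bot, so \bot is the join of no atoms. *)
Definition atomistic {d : Order.disp_t} (L : finTBLatticeType d) : Prop :=
  forall x : L, exists A : {set L},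
    (forall a, a \in A -> atom a) /\ x = (\join_(a in A) a)%O.

(* Every (x, y) in Z^2 with 0 <= x, 0 <= y and x + y <= n has both
   coordinates in {0, ..., n}, so the ambient Z^2 is cut down to this grid;
   the grid is closed under coordinatewise min and max. *)
Definition point (n : nat) : finType := ('I_n.+1 * 'I_n.+1)%type.

Definition Q (n : nat) : {set point n} := [set p : point n | p.1 + p.2 <= n].

Definition pmin {n : nat} (p q : point n) : point n :=
  (Order.min p.1 q.1, Order.min p.2 q.2).

Definition pmax {n : nat} (p q : point n) : point n :=
  (Order.max p.1 q.1, Order.max p.2 q.2).

Definition closed_subset {n : nat} (Y : {set point n}) : bool :=
  (Y \subset Q n) &&
  [forall p in Y, forall q in Y,
     ((pmax p q).1 + (pmax p q).2 <= n.+1) ==>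
       (pmin p q \in Y) && ((pmax p q \in Q n) ==> (pmax p q \in Y))].

Record R (n : nat) := MkR { rset :> {set point n}; rsetP : closed_subset rset }.

HB.instance Definition _ n := [isSub for @rset n].
HB.instance Definition _ n := [Finite of R n by <:].

Lemma closed_subsetP n (Y : {set point n}) :
  reflect (Y \subset Q n /\
           forall p q, p \in Y -> q \in Y ->
             (pmax p q).1 + (pmax p q).2 <= n.+1 ->
             pmin p q \in Y /\ (pmax p q \in Q n -> pmax p q \in Y))
          (closed_subset Y).
Proof.
apply: (iffP andP) => -[YQ H]; split=> //.
  move=> p q pY qY le_pq; move/forall_inP: H => /(_ p pY) /forall_inP /(_ q qY).
  by rewrite le_pq => /andP[? /implyP].
apply/forall_inP => p pY; apply/forall_inP => q qY; apply/implyP => le_pq.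
by have [-> /implyP] := H p q pY qY le_pq.
Qed.

Lemma closed_subset0 n : closed_subset (set0 : {set point n}).
Proof. by apply/closed_subsetP; split=> [|p q]; rewrite ?sub0set ?inE. Qed.

Lemma closed_subsetT n : closed_subset (Q n).
Proof.
apply/closed_subsetP; split=> // p q pQ _ _; split=> //.
move: pQ; rewrite !inE; apply: leq_trans.
have le_min (i j : 'I_n.+1) : (Order.min i j <= i)%N.
  by change (Order.min i j <= i)%O; rewrite ge_min lexx.
by apply: leq_add; apply: le_min.
Qed.

Lemma closed_subsetI n (X Y : {set point n}) :
  closed_subset X -> closed_subset Y -> closed_subset (X :&: Y).
Proof.
move=> /closed_subsetP[XQ HX] /closed_subsetP[_ HY]; apply/closed_subsetP.
split=> [|p q]; first exact: subset_trans (subsetIl _ _) XQ.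
rewrite !inE => /andP[pX pY] /andP[qX qY] le_pq.
have [-> MX] := HX p q pX qX le_pq; have [-> MY] := HY p q pY qY le_pq.
by split=> // MQ; rewrite MX ?inE // MY ?inE.
Qed.

Definition Rmeet n (X Y : R n) : R n := MkR (closed_subsetI (rsetP X) (rsetP Y)).

(* Since Q n itself is closed and contains X :|: Y, this is the intersection
   of all elements of R n containing X :|: Y. *)
Definition Rjoin n (X Y : R n) : R n :=
  \big[@Rmeet n/MkR (closed_subsetT n)]_(Z : R n | rset X :|: rset Y \subset rset Z) Z.

Fact R_display : Order.disp_t. Proof. exact: Order.Disp tt tt. Qed.

Definition Rle n (X Y : R n) : bool := rset X \subset rset Y.

Lemma Rle_refl n : reflexive (@Rle n).
Proof. by move=> X; apply: subxx. Qed.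

Lemma Rle_anti n : antisymmetric (@Rle n).
Proof. by move=> X Y H; apply/val_inj/eqP; rewrite eqEsubset. Qed.

Lemma Rle_trans n : transitive (@Rle n).
Proof. by move=> Y X Z; apply: subset_trans. Qed.

HB.instance Definition _ n :=
  Order.Le_isPOrder.Build R_display (R n) (@Rle_refl n) (@Rle_anti n) (@Rle_trans n).

Lemma RmeetP n (X Y Z : R n) : (X <= Rmeet Y Z)%O = (X <= Y)%O && (X <= Z)%O.
Proof. exact: subsetI. Qed.

Lemma le_Rjoin n (X Y W : R n) :
  (W <= Rjoin X Y)%O =
  [forall (Z : R n | rset X :|: rset Y \subset rset Z), W <= Z]%O.
Proof.
rewrite /Rjoin -big_andE.
apply: (big_morph (fun Z => W <= Z)%O) => [Y1 Y2|]; first exact: RmeetP.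
by have /closed_subsetP[] := rsetP W.
Qed.

Lemma RjoinP n (X Y Z : R n) : (Rjoin X Y <= Z)%O = (X <= Z)%O && (Y <= Z)%O.
Proof.
apply/idP/idP => [le_Z | /andP[XZ YZ]]; last first.
  have := lexx (Rjoin X Y); rewrite le_Rjoin => /forall_inP; apply.
  by rewrite subUset; apply/andP.
apply/andP; split; apply: le_trans le_Z; rewrite le_Rjoin;
  by apply/forall_inP => W; rewrite subUset => /andP[].
Qed.

HB.instance Definition _ n :=
  Order.POrder_MeetJoin_isLattice.Build R_display (R n) (@RmeetP n) (@RjoinP n).

Lemma R_le0x n (X : R n) : (MkR (closed_subset0 n) <= X)%O.
Proof. exact: sub0set. Qed.

Lemma R_lex1 n (X : R n) : (X <= MkR (closed_subsetT n))%O.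
Proof. by have /closed_subsetP[] := rsetP X. Qed.

HB.instance Definition _ n := Order.hasBottom.Build R_display (R n) (@R_le0x n).
HB.instance Definition _ n := Order.hasTop.Build R_display (R n) (@R_lex1 n).

(* Main.v *)
(** Every singleton contained in [Q n] is closed, because [pmin p p] and
    [pmax p p] are both [p]. Hence the singletons are the atoms and every closed
    set is the join of the singletons it contains; in any finite atomistic
    lattice the join-irreducible elements are the atoms. *)
Require Import Defs.
From mathcomp Require Import all_boot all_order.

Set Implicit Arguments.
Unset Strict Implicit.
Unset Printing Implicit Defensive.

Import Order.TTheory.

Section AtomisticLattice.

Context {d : Order.disp_t} {L : finTBLatticeType d}.

(** If [x] is the join of [y] and [z], then [y] lies below [x], so it is [x] or [\bot]; in the
    latter case [z] is [x]. *)
Lemma atom_join_irreducible (x : L) : atom x -> join_irreducible x.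
Proof.
move=> [x_gt0 x_min]; split=> [x0 | y z xyz]; first by rewrite x0 ltxx in x_gt0.
have: (y <= x)%O by rewrite xyz leUl.
rewrite le_eqVlt => /predU1P[-> | /x_min y0]; first by left.
by right; rewrite xyz y0 join0x.
Qed.

(** Induction on the join: the empty one is [\bot], which is excluded, and otherwise irreducibility
    makes [x] equal to the first element or to the join of the rest. *)
Lemma join_irreducible_bigjoin (x : L) (A : {set L}) :
  join_irreducible x -> x = (\join_(a in A) a)%O -> x \in A.
Proof.
move=> [x_neq0 x_irr].
elim/big_rec: _ => [/x_neq0 // | a z aA IHz /x_irr[-> | /IHz]] //.
Qed.

Lemma atomistic_join_irreducible (x : L) :
  atomistic L -> join_irreducible x <-> atom x.
Proof.
move=> atL; split=> [x_irr | ]; last exact: atom_join_irreducible.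
have [A [A_atoms xA]] := atL x.
exact/A_atoms/join_irreducible_bigjoin.
Qed.

Lemma atomistic_atomic : atomistic L -> atomic L.
Proof.
move=> atL x x_neq0; have [A [A_atoms xA]] := atL x.
have [A0 | [a aA]] := set_0Vmem A; first by case: x_neq0; rewrite xA A0 big_set0.
by exists a; [exact: A_atoms | rewrite xA joins_sup].
Qed.

End AtomisticLattice.

Section Singletons.

Variable n : nat.
Implicit Types (p q : point n) (X Y : R n).

Lemma rset_subQ X : rset X \subset Q n.
Proof. by case/closed_subsetP: (rsetP X). Qed.

Lemma closed_subset1 p : p \in Q n -> closed_subset [set p].
Proof.
move=> pQ; apply/closed_subsetP; split=> [|q r /set1P-> /set1P-> _].
  by rewrite sub1set.
by rewrite /pmin /pmax !minxx !maxxx -surjective_pairing set11.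
Qed.

Definition R1 p (pQ : p \in Q n) : R n := MkR (closed_subset1 pQ).

Lemma R1_le p (pQ : p \in Q n) X : (R1 pQ <= X)%O = (p \in rset X).
Proof. exact: sub1set. Qed.

Lemma rset_eq0 X : (rset X == set0) = (X == \bot%O).
Proof. by []. Qed.

Lemma R1_atom p (pQ : p \in Q n) : atom (R1 pQ).
Proof.
split=> [|Y]; first by rewrite lt0x -rset_eq0 -cards_eq0 cards1.
(* The order is inclusion by conversion, so [Y] is either the singleton itself or empty. *)
rewrite lt_neqAle => /andP[Y_neq]; rewrite [(_ <= _)%O]subset1 => /orP[/eqP Yp|].
  by case/eqP: Y_neq; apply: val_inj.
by rewrite rset_eq0 => /eqP.
Qed.

(** An atom has some point [p]; the singleton of [p] lies below it and is not [\bot], so minimality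
    forces equality. *)
Lemma atom_R1 X : atom X -> exists p, exists pQ : p \in Q n, X = R1 pQ.
Proof.
move=> [X_gt0 X_min]; have: rset X != set0 by rewrite rset_eq0 -lt0x.
case/set0Pn=> p pX; have pQ := subsetP (rset_subQ X) p pX.
exists p, pQ; move: pX; rewrite -(R1_le pQ) le_eqVlt => /predU1P[-> // | /X_min p0].
by case: (R1_atom pQ); rewrite p0 ltxx.
Qed.

Lemma R_atomistic : atomistic (R n).
Proof.
(* Comparing underlying sets avoids [R1], which would need a proof of [p \in Q n] inside the
   comprehension. *)
move=> X; exists [set a : R n | [exists p in rset X, rset a == [set p]]].
split=> [a | ].
  rewrite inE => /exists_inP[p pX /eqP ap].
  have pQ := subsetP (rset_subQ X) p pX.
  by have -> : a = R1 pQ; [exact: val_inj | exact: R1_atom].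
apply: le_anti; apply/andP; split.
  apply/subsetP=> p pX; have pQ := subsetP (rset_subQ X) p pX.
  rewrite -(R1_le pQ); apply: joins_sup; rewrite inE.
  by apply/exists_inP; exists p.
apply/joinsP=> a; rewrite inE => /exists_inP[p pX /eqP ap].
by rewrite [(_ <= _)%O](_ : _ = (rset a \subset rset X)) // ap sub1set.
Qed.

End Singletons.

Theorem mainTheorem10 (n : nat) :
  (forall Y : {set point n},
     (exists2 X : R n, atom X & rset X = Y) <->
     (exists2 p : point n, p \in Q n & Y = [set p])) /\
  atomic (R n) /\
  atomistic (R n) /\
  (forall X : R n, join_irreducible X <-> atom X).
Proof.
have atR := @R_atomistic n.
split; [move=> Y; split | split; [exact: atomistic_atomic | split=> // X]].
- by case=> X /atom_R1[p [pQ ->]] <-; exists p.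
- by case=> p pQ ->; exists (R1 pQ); first exact: R1_atom.
- exact: atomistic_join_irreducible.
Qed.
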